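(* Let $X\in\mathcal{D}^-$ and let $Z$ be a random variable. (a) If $X$ is in the sum-domain of attraction of $Z$, i.e. there exist $a_n>0$ and $b_n\in\mathbb{R}$ such that $a_n(X_1+\dots+X_n)-b_n\to Z$ in distribution, where $X_1,X_2,\dots$ are i.i.d. copies of $X$, then $Z\in\mathcal{D}^-$. (b) If $X$ is in the max-domain of attraction of $Z$, i.e. there exist $a_n>0$ and $b_n\in\mathbb{R}$ such that $a_n\max\{X_1,\dots,X_n\}-b_n\to Z$ in distribution, where $X_1,X_2,\dots$ are i.i.d. copies of $X$, then $Z\in\mathcal{D}^-$.
   Context: For real random variables, $X \le_{st} Y$ means $P(X\le t)\ge P(Y\le t)$ for all $t\in\mathbb{R}$. A real random variable $X$ (equivalently its distribution function $F_X$) belongs to $\mathcal{D}^-$ if for every $n\in\mathbb{N}$, all $\theta_1,\dots,\theta_n\ge 0$ with $\sum_{i=1}^n\theta_i=1$, and i.i.d. random variables $X_1,\dots,X_n$ with distribution $F_X$, we have $X_1\le_{st}\sum_{i=1}^n\theta_iX_i$. *)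

(* Defs.v *)
From HB Require Import structures.
From mathcomp Require Import all_boot all_order all_algebra.
From mathcomp Require Import all_classical all_reals all_analysis.
Set Implicit Arguments. Unset Strict Implicit. Unset Printing Implicit Defensive.
Import Order.TTheory GRing.Theory Num.Theory.
Import numFieldNormedType.Exports.
Local Open Scope classical_set_scope.
Local Open Scope ring_scope.

Definition distrF d (T : measurableType d) (R : realType) (P : probability T R)
  (X : T -> R) (t : R) : R := fine (P [set w | X w <= t]).

Definition realRV d (T : measurableType d) (R : realType) (X : T -> R) : Prop :=
  measurable_fun [set: T] X.

(* Mutual independence of a finite family of real random variables:
   product rule for all families of Borel sets (taking B i = setT for
   unused indices this covers every subfamily). *)
Definition indep_fin d (T : measurableType d) (R : realType) (P : probability T R)
  (n : nat) (X : 'I_n -> T -> R) : Prop :=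
  forall B : 'I_n -> set R, (forall i, measurable (B i)) ->
    P (\bigcap_(i in [set: 'I_n]) (X i @^-1` B i)) = (\prod_(i < n) P (X i @^-1` B i))%E.

(* Mutual independence of a sequence: every finite subfamily (equivalently
   every initial segment) is mutually independent. *)
Definition indep_seq d (T : measurableType d) (R : realType) (P : probability T R)
  (X : nat -> T -> R) : Prop :=
  forall n, indep_fin P (fun i : 'I_n => X (nat_of_ord i)).

Definition st_le (R : realType) (FX FY : R -> R) : Prop :=
  forall t, FY t <= FX t.

(* The class D^- of distribution functions F:
   for every n >= 1 (n.+1 below; n = 0 is excluded by sum theta = 1),
   all theta_i >= 0 summing to 1 and all i.i.d. X_1..X_n with distribution F
   (on any probability space), X_1 <=_st sum theta_i X_i. *)
Definition D_minus (R : realType) (F : R -> R) : Prop :=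
  forall (d : measure_display) (T : measurableType d) (P : probability T R)
         (n : nat) (theta : 'I_n.+1 -> R) (X : 'I_n.+1 -> T -> R),
    (forall i, 0 <= theta i) -> \sum_(i < n.+1) theta i = 1 ->
    (forall i, realRV (X i)) -> indep_fin P X ->
    (forall i t, distrF P (X i) t = F t) ->
    st_le (distrF P (X ord0)) (distrF P (fun w => \sum_(i < n.+1) theta i * X i w)).

Definition cvg_in_distr (R : realType) (Fn : nat -> R -> R) (F : R -> R) : Prop :=
  forall t, {for t, continuous F} -> (fun n => Fn n t) @ \oo --> F t.

Definition sum_domain_attr (R : realType) (FX FZ : R -> R) : Prop :=
  exists (d : measure_display) (T : measurableType d) (P : probability T R)
         (Xs : nat -> T -> R) (a b : nat -> R),
    (forall i, realRV (Xs i)) /\ indep_seq P Xs /\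
    (forall i t, distrF P (Xs i) t = FX t) /\
    (forall n, 0 < a n) /\
    cvg_in_distr (fun n => distrF P
                    (fun w => a n * (\sum_(i < n.+1) Xs i w) - b n)) FZ.

Definition max_domain_attr (R : realType) (FX FZ : R -> R) : Prop :=
  exists (d : measure_display) (T : measurableType d) (P : probability T R)
         (Xs : nat -> T -> R) (a b : nat -> R),
    (forall i, realRV (Xs i)) /\ indep_seq P Xs /\
    (forall i t, distrF P (Xs i) t = FX t) /\
    (forall n, 0 < a n) /\
    cvg_in_distr (fun n => distrF P
                    (fun w => a n * (\big[Num.max/Xs 0%N w]_(i < n.+1) Xs i w) - b n)) FZ.

(* Main.v *)
Require Import Defs.
From HB Require Import structures.
From mathcomp Require Import all_boot all_order all_algebra.
From mathcomp Require Import all_classical all_reals all_analysis.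
From mathcomp Require Import measurable_realfun.
From mathcomp Require Import lra.
Set Implicit Arguments. Unset Strict Implicit. Unset Printing Implicit Defensive.
Import Order.TTheory GRing.Theory Num.Theory.
Import numFieldNormedType.Exports.
Local Open Scope classical_set_scope.
Local Open Scope ring_scope.

(* Put the variables X_ij, i <= k, j <= n, in an array of i.i.d. copies of X, and let agg be the
   sum or the maximum.  Since agg is sublinear, the weighted sum over the rows i of agg_j X_ij
   dominates agg_j T_j with T_j := sum_i theta_i X_ij pointwise; the T_j are independent, dominate
   X in the stochastic order because X is in D^-, and agg preserves the stochastic order of
   independent families.  So the defining inequality of D^- holds for the normalised aggregates.
   It survives the limit because convergence in distribution gives F_Z(x) <= F_n(x + e) + f
   uniformly in x for large n (half of convergence in the Levy metric), and such one-sided bounds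
   add up over independent summands. *)

(** * Independence: from generating systems to sigma-algebras, and regrouping of families *)

(** The product rule is stated for full families only; subfamilies are covered as soon as every
    [G k] contains [setT]. *)
Definition indep_sys d (T : measurableType d) (R : realType) (P : probability T R)
  (K : finType) (G : K -> set (set T)) : Prop :=
  forall A : K -> set T, (forall k, G k (A k)) ->
    P (\big[setI/setT]_k A k) = (\prod_k P (A k))%E.

(* The systems are replaced by their sigma-algebras one at a time: with the other events fixed,
   both sides are finite measures of the remaining event that agree on a pi-system. *)
Lemma indep_sys_sigma d (T : measurableType d) (R : realType) (P : probability T R)
  (K : finType) (G : K -> set (set T)) :
  (forall k, G k `<=` measurable) -> (forall k, setI_closed (G k)) ->
  (forall k, G k setT) -> indep_sys P G -> indep_sys P (fun k => <<s G k >>).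
Proof.
move=> mG IG TG iG.
have sGm k : <<s G k >> `<=` measurable.
  by apply: smallest_sub => //; exact: sigma_algebra_measurable.
(* [r] lists the indices already passed to their sigma-algebras; the lemma is the case of the full
   enumeration. *)
suff H (r : seq K) : indep_sys P (fun k => if k \in r then <<s G k >> else G k).
  by move=> A hA; apply: (H (enum K)) => k; rewrite mem_enum; exact: hA.
elim: r => [|k0 r IH] A hA; first by apply: iG => k; have := hA k.
have [k0r|k0r] := boolP (k0 \in r).
  apply: IH => k; have := hA k; rewrite inE.
  by case: eqP => [->|//]; rewrite k0r.
have mA k : measurable (A k).
  by have := hA k; case: ifP => _; [move/sGm|move/mG].
pose E := \big[setI/setT]_(k | k != k0) A k.
have mE : measurable E by exact: bigsetI_measurable.
have IH' S : G k0 S -> (P (S `&` E) = P S * \prod_(k | k != k0) P (A k))%E.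
  move=> GS; pose A' k := if k == k0 then S else A k.
  have /IH : forall k, (if k \in r then <<s G k >> else G k) (A' k).
    move=> k; rewrite /A'; case: eqP => [->|kk]; first by rewrite (negbTE k0r).
    by have := hA k; rewrite inE; case: eqP.
  rewrite (bigD1 k0)//= [in RHS](bigD1 k0)//= {1 3}/A' eqxx.
  rewrite (eq_bigr A) => [|k /negbTE]; last by rewrite /A' => ->.
  by rewrite (eq_bigr (P \o A)) // => k /negbTE; rewrite /A'/= => ->.
(* The case [S := setT] of [IH'] evaluates [P E]. *)
have PE : P E = (\prod_(k | k != k0) P (A k))%E.
  by have := IH' _ (TG k0); rewrite setTI probability_setT mul1e.
have c0 : 0 <= fine (P E) by exact: fine_ge0.
rewrite (bigD1 k0)//= [in RHS](bigD1 k0)//= -PE.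
have -> : (P (A k0) * P E = mscale (NngNum c0) P (A k0))%E.
  by rewrite /mscale /= fineK ?fin_num_measure// muleC.
change (mrestr P mE (A k0) = mscale (NngNum c0) P (A k0)).
apply: (g_sigma_algebra_measure_unique (G k0) (@mG k0) (fun=> setT)) => //.
- by rewrite bigcup_const; last by exists 0%N.
- move=> S GS; change (P (S `&` E) = (fine (P E))%:E * P S)%E.
  by rewrite IH'// fineK ?fin_num_measure// PE muleC.
- by move=> _; rewrite /= /mrestr /= setTI (le_lt_trans (probability_le1 P mE)) ?ltry.
- by have := hA k0; rewrite mem_head.
Qed.

Definition indep_fam d (T : measurableType d) (R : realType) (P : probability T R)
  (I : finType) (X : I -> T -> R) : Prop :=
  forall B : I -> set R, (forall i, measurable (B i)) ->
    P (\big[setI/setT]_i (X i @^-1` B i)) = (\prod_i P (X i @^-1` B i))%E.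

Lemma indep_finE d (T : measurableType d) (R : realType) (P : probability T R)
  n (X : 'I_n -> T -> R) : indep_fin P X <-> indep_fam P X.
Proof.
have H (F : 'I_n -> set T) : \bigcap_(i in [set: 'I_n]) F i = \big[setI/setT]_i F i.
  by rewrite -bigcap_seq; congr bigcap; apply/seteqP; split=> i //= _; rewrite mem_index_enum.
by split=> h B mB; have := h B mB; rewrite H.
Qed.

(** Indices outside the image of [h] receive [setT], which is neutral on both sides of the product
    rule. *)
Lemma indep_fam_inj d (T : measurableType d) (R : realType) (P : probability T R)
  (I J : finType) (h : J -> I) (X : I -> T -> R) :
  injective h -> indep_fam P X -> indep_fam P (X \o h).
Proof.
move=> hi iX B mB.
pose B' i := if [pick j | h j == i] is Some j then B j else setT.
have B'h j : B' (h j) = B j.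
  rewrite /B'; case: pickP => [k /eqP/hi -> //|/(_ j)]; by rewrite eqxx.
have B'n i : i \notin (h @: [set: J])%SET -> B' i = setT.
  rewrite /B' => /imsetP nh; case: pickP => [k /eqP hk|//].
  by exfalso; apply: nh; exists k; rewrite ?inE.
have mB' i : measurable (B' i) by rewrite /B'; case: pickP.
(* Stated for any commutative monoid, to serve both the intersection and the product of
   probabilities. *)
have key S (idx : S) (op : Monoid.com_law idx) (F : I -> S) :
    (forall i, i \notin (h @: [set: J])%SET -> F i = idx) ->
    \big[op/idx]_i F i = \big[op/idx]_j F (h j).
  move=> F1; rewrite (bigID (mem (h @: [set: J]%SET)))/= [X in op _ X]big1// Monoid.mulm1.
  rewrite big_imset/=; last by move=> ? ? _ _ /hi.
  by apply: eq_bigl => j; rewrite inE.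
have := iX B' mB'; rewrite key; last by move=> i /B'n ->; rewrite preimage_setT.
rewrite [in X in _ = X -> _]key; last first.
  by move=> i /B'n ->; rewrite preimage_setT probability_setT.
by under eq_bigr do rewrite B'h; under [in X in _ = X -> _]eq_bigr do rewrite B'h.
Qed.

(** These cylinders form a pi-system generating the sigma-algebra of the variables [X i] with [p i];
    being measurable for that sigma-algebra encodes being a function of this block alone. *)
Definition block_rect d (T : measurableType d) (R : realType)
  (I : finType) (X : I -> T -> R) (p : pred I) : set (set T) :=
  [set A | exists2 B : I -> set R, (forall i, measurable (B i)) &
     A = \big[setI/setT]_(i | p i) (X i @^-1` B i)].

Notation block_sigma X p := (g_sigma_algebraType (block_rect X p)).

Lemma measurable_block d (T : measurableType d) (R : realType)
  (I : finType) (X : I -> T -> R) (p : pred I) i : p i ->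
  measurable_fun [set: block_sigma X p] (X i).
Proof.
move=> pi _ B mB; rewrite setTI; apply: sub_sigma_algebra.
exists (fun j => if j == i then B else setT); first by move=> j; case: ifP.
rewrite (bigD1 i)//= eqxx big1 ?setIT// => j /andP[_ /negbTE ->].
by rewrite preimage_setT.
Qed.

(** The fibres of [g] partition [I], so cylinders over distinct fibres are independent by regrouping
    products; [indep_sys_sigma] carries this to the generated sigma-algebras, which contain the
    events of the [Y k]. *)
Lemma indep_fam_group d (T : measurableType d) (R : realType) (P : probability T R)
  (I K : finType) (g : I -> K) (X : I -> T -> R) (Y : K -> T -> R) :
  (forall i, measurable_fun setT (X i)) -> indep_fam P X ->
  (forall k, measurable_fun [set: block_sigma X (fun i => g i == k)] (Y k)) ->
  indep_fam P Y.
Proof.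
move=> mX iX mY B mB.
have := @indep_sys_sigma _ T R P K (fun k => block_rect X (fun i => g i == k)).
apply.
- move=> k _ [C mC ->]; apply: bigsetI_measurable => i _.
  by rewrite -[_ @^-1` _]setTI; exact: mX.
- move=> k _ _ [C mC ->] [D mD ->]; exists (fun i => C i `&` D i).
    by move=> i; exact: measurableI.
  by rewrite -big_split.
- move=> k; exists (fun=> setT) => //.
  by rewrite big1// => i _; rewrite preimage_setT.
- move=> A hA.
  have /choice[C hC] : forall k, exists C : I -> set R, (forall i, measurable (C i)) /\
      A k = \big[setI/setT]_(i | g i == k) (X i @^-1` C i).
    by move=> k; have [C mC ->] := hA k; exists C.
  rewrite (eq_bigr (fun k => \big[setI/setT]_(i | g i == k) (X i @^-1` C k i))); last first.
    by move=> k _; have [_ ->] := hC k.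
  have mC i : measurable (C (g i) i) by have [+ _] := hC (g i); apply.
  have -> : \big[setI/setT]_k \big[setI/setT]_(i | g i == k) (X i @^-1` C k i) =
      \big[setI/setT]_i (X i @^-1` C (g i) i).
    rewrite (partition_big g predT)//=; apply: eq_bigr => k _.
    by apply: eq_bigr => i /eqP ->.
  rewrite iX//= (partition_big g predT)//=; apply: eq_bigr => k _.
  have [mCk ->] := hC k.
  (* A second use of independence, with [setT] off the block [k], factors the probability of the
     single cylinder [A k]. *)
  have mCk' i : measurable (if g i == k then C k i else setT) by case: ifP.
  have := iX _ mCk'.
  rewrite (bigID (fun i => g i == k))/= [X in _ `&` X]big1 ?setIT; last first.
    by move=> i /negbTE ->; rewrite preimage_setT.
  rewrite [in X in _ = X -> _](bigID (fun i => g i == k))/=.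
  rewrite [X in (_ * X)%E]big1 ?mule1; last first.
    by move=> i /negbTE ->; rewrite preimage_setT probability_setT.
  under eq_bigr => i ik do rewrite ik.
  under [in X in _ = X -> _]eq_bigr => i ik do rewrite ik.
  move=> ->.
  by apply: eq_bigr => i /eqP ->.
- by move=> k; rewrite -[_ @^-1` _]setTI; exact: mY.
Qed.

(** * Product measures of half-planes, and the law of a sum of two independent variables *)

Definition half_plane (R : realType) (t : R) : set (R * R) := [set x | x.1 + x.2 <= t].

Lemma measurable_half_plane (R : realType) (t : R) : measurable (half_plane t).
Proof.
rewrite (_ : half_plane t = (fun x : R * R => x.1 + x.2) @^-1` `]-oo, t]); last first.
  by apply/seteqP; split=> x/=; rewrite in_itv.
rewrite -[X in measurable X]setTI; exact: (measurable_funD measurable_fst measurable_snd).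
Qed.

Lemma xsection_half_plane (R : realType) (t x : R) :
  xsection (half_plane t) x = [set y | y <= t - x].
Proof. by apply/seteqP; split=> y /=; rewrite xsectionE /half_plane /= lerBrDl. Qed.

Lemma ysection_half_plane (R : realType) (t y : R) :
  ysection (half_plane t) y = [set x | x <= t - y].
Proof. by apply/seteqP; split=> x /=; rewrite ysectionE /half_plane /= lerBrDr. Qed.

Section half_plane_products.
Context (R : realType).
Implicit Types m : probability R R.
Local Open Scope ereal_scope.

(* Fubini's theorem together with the symmetry of the half-plane. *)
Lemma half_plane_productC m1 m2 t :
  (m1 \x m2) (half_plane t) = (m2 \x m1) (half_plane t).
Proof.
rewrite (@product_measure_unique _ _ _ _ R m1 m2 (m1 \x^ m2)).
- by rewrite /product_measure2 /product_measure1; apply: eq_integral => x _ /=;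
    rewrite xsection_half_plane ysection_half_plane.
- by move=> A B mA mB; exact: product_measure2E.
- exact: measurable_half_plane.
Qed.

(** Sections of a half-plane are rays, so the hypothesis bounds the integrand pointwise; the
    constant [d] integrates to itself because [m] has mass 1. *)
Lemma half_plane_product_le m m1 m2 (e d : R) :
  (0 <= d)%R -> (forall x, m1 [set y | (y <= x)%R] <= m2 [set y | (y <= x + e)%R] + d%:E) ->
  forall t, (m \x m1) (half_plane t) <= (m \x m2) (half_plane (t + e)%R) + d%:E.
Proof.
move=> d0 h t; rewrite /product_measure1.
have mf (n : probability R R) s : measurable_fun setT (n \o xsection (half_plane s)).
  by apply: measurable_fun_xsection; exact: measurable_half_plane.
rewrite -[leRHS](_ : \int[m]_x ((m2 \o xsection (half_plane (t + e)%R)) x + d%:E) = _).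
  apply: ge0_le_integral => //.
  - exact: emeasurable_funD.
  - move=> x _; rewrite /= !xsection_half_plane.
    by rewrite -addrAC; exact: h.
rewrite ge0_integralD//.
rewrite integral_cst//; congr (_ + _); rewrite -[RHS]mule1; congr (_ * _).
exact: probability_setT.
Qed.

End half_plane_products.

Definition indep2 d (T : measurableType d) (R : realType) (P : probability T R)
  (U V : T -> R) := forall A B, measurable A -> measurable B ->
  P (U @^-1` A `&` V @^-1` B) = (P (U @^-1` A) * P (V @^-1` B))%E.

(** By independence the joint law agrees with the product of the marginal laws on rectangles, hence
    everywhere. *)
Lemma indep2_add d (T : measurableType d) (R : realType) (P : probability T R)
    (U V : {mfun T >-> R}) t : indep2 P U V ->
  P [set w | U w + V w <= t] = (distribution P U \x distribution P V)%E (half_plane t).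
Proof.
move=> UV.
have mUV : measurable_fun setT (fun w => (U w, V w)) by exact: measurable_fun_pair.
pose W : {mfun T >-> (R * R)%type} := mfun_Sub (mem_set mUV).
rewrite (@product_measure_unique _ _ _ _ _ (distribution P U) (distribution P V)
  (distribution P W))//; exact: measurable_half_plane.
Qed.

(** * Elementary facts on distribution functions *)

Section distrF_basics.
Context d (T : measurableType d) (R : realType) (P : probability T R) (X : T -> R).
Hypothesis mX : measurable_fun setT X.

Lemma measurable_le_cst t : measurable [set w | X w <= t].
Proof.
rewrite (_ : [set w | X w <= t] = X @^-1` `]-oo, t]); last first.
  by apply/seteqP; split=> x/=; rewrite in_itv.
by rewrite -[X in measurable X]setTI; exact: mX.
Qed.

Lemma distrFE t : (distrF P X t)%:E = P [set w | X w <= t].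
Proof. by rewrite /distrF fineK// fin_num_measure//; exact: measurable_le_cst. Qed.

Lemma distrF_ge0 t : 0 <= distrF P X t.
Proof. exact: fine_ge0. Qed.

Lemma distrF_le1 t : distrF P X t <= 1.
Proof. by rewrite -lee_fin distrFE; exact/probability_le1/measurable_le_cst. Qed.

End distrF_basics.

Lemma distrF_cst d (T : measurableType d) (R : realType) (P : probability T R) (c t : R) :
  distrF P (fun=> c) t = (c <= t)%R%:R.
Proof.
rewrite /distrF (_ : [set w : T | (c <= t)%R] = if (c <= t)%R then setT else set0).
  by case: ifP; rewrite ?probability_setT ?measure0.
by case: ifP => ct; apply/seteqP; split.
Qed.

Lemma le_distrF d (T : measurableType d) (R : realType) (P : probability T R)
    (X Y : T -> R) s t : measurable_fun setT X -> measurable_fun setT Y ->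
  (forall w, X w <= s -> Y w <= t) -> distrF P X s <= distrF P Y t.
Proof.
move=> mX mY h; rewrite -lee_fin !distrFE//; apply: le_measure.
- by rewrite inE; exact: measurable_le_cst.
- by rewrite inE; exact: measurable_le_cst.
- exact: h.
Qed.

(** * Comparison of sums of independent variables *)

(** The summands are exchanged one at a time, first [V] for [V'], then [U] for [U']. The
    intermediate pair [U], [V'] lives on no common space, so the argument runs on product measures
    of the laws; [half_plane_productC] brings the factor to be changed into second place. *)
Lemma distrF_add_le d (T : measurableType d) d' (T' : measurableType d') (R : realType)
    (P : probability T R) (P' : probability T' R) (U V : T -> R) (U' V' : T' -> R)
    (e1 e2 d1 d2 : R) :
  measurable_fun setT U -> measurable_fun setT V ->
  measurable_fun setT U' -> measurable_fun setT V' ->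
  indep2 P U V -> indep2 P' U' V' -> 0 <= d1 -> 0 <= d2 ->
  (forall x, distrF P U x <= distrF P' U' (x + e1) + d1) ->
  (forall x, distrF P V x <= distrF P' V' (x + e2) + d2) ->
  forall t, distrF P (fun w => U w + V w) t <=
    distrF P' (fun w => U' w + V' w) (t + (e1 + e2)) + (d1 + d2).
Proof.
move=> mU mV mU' mV' iUV iUV' d10 d20 hU hV t.
pose u : {mfun T >-> R} := mfun_Sub (mem_set mU).
pose v : {mfun T >-> R} := mfun_Sub (mem_set mV).
pose u' : {mfun T' >-> R} := mfun_Sub (mem_set mU').
pose v' : {mfun T' >-> R} := mfun_Sub (mem_set mV').
rewrite -lee_fin EFinD !distrFE; [|exact: measurable_funD..].
rewrite (@indep2_add _ _ _ P u v)// (@indep2_add _ _ _ P' u' v')//.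
apply: (le_trans (@half_plane_product_le _ _ _ (distribution P' v') e2 d2 d20 _ t)).
  by move=> x; have := hV x; rewrite -lee_fin EFinD !distrFE.
rewrite half_plane_productC.
apply: (le_trans (leeD2r _ (@half_plane_product_le _ _ _ (distribution P' u') e1 d1 d10 _ _))).
  by move=> x; have := hU x; rewrite -lee_fin EFinD !distrFE.
by rewrite half_plane_productC -addeA -EFinD [e1 + e2]addrC addrA [d1 + d2]addrC.
Qed.

(** Regrouping into two blocks, the index [j] and all other indices. *)
Lemma indep_fam_sum d (T : measurableType d) (R : realType) (P : probability T R)
    (I : finType) (X : I -> T -> R) (r : seq I) (j : I) :
  (forall i, measurable_fun setT (X i)) -> indep_fam P X -> j \notin r ->
  indep2 P (X j) (fun w => \sum_(i <- r) X i w).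
Proof.
move=> mX iX jr A B mA mB.
pose Y (b : bool) := if b then X j else (fun w => \sum_(i <- r) X i w).
have := @indep_fam_group _ _ _ P I bool (fun i => i == j) X Y mX iX.
move=> /(_ _ (fun b => if b then A else B)); rewrite !big_bool/=; apply.
  case; first by apply: measurable_block; rewrite eqxx.
  (* [measurable_sum] asks for measurability of every term, even at [j], which is not in the block;
     as [j] is not in [r], its term may be replaced by 0. *)
  rewrite /Y [X in measurable_fun _ X](_ : _ =
    (fun w => \sum_(i <- r) (if i == j then cst 0 else X i) w)); last first.
    apply/funext => w; rewrite big_seq [RHS]big_seq; apply: eq_bigr => i ir.
    by case: eqP => // ij; move: jr; rewrite -ij ir.
  apply: measurable_sum => i; case: eqP => [_|/eqP ij]; first exact: measurable_cst.
  by apply: measurable_block; rewrite eqbF_neg.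
by case.
Qed.

(** Induction on the enumeration of [I]: [indep_fam_sum] makes each variable independent of the sum
    of the following ones, so [distrF_add_le] applies. *)
Lemma distrF_sum_le d (T : measurableType d) d' (T' : measurableType d') (R : realType)
    (P : probability T R) (P' : probability T' R) (I : finType)
    (X : I -> T -> R) (Y : I -> T' -> R) (e f : I -> R) :
  (forall i, measurable_fun setT (X i)) -> (forall i, measurable_fun setT (Y i)) ->
  indep_fam P X -> indep_fam P' Y -> (forall i, 0 <= f i) ->
  (forall i x, distrF P (X i) x <= distrF P' (Y i) (x + e i) + f i) ->
  forall t, distrF P (fun w => \sum_i X i w) t <=
    distrF P' (fun w => \sum_i Y i w) (t + \sum_i e i) + \sum_i f i.
Proof.
move=> mX mY iX iY f0 hXY.
elim: (index_enum I) (index_enum_uniq I) => [_|i r IH /= /andP[ir ur]] t.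
  rewrite !big_nil !addr0.
  by under eq_fun do rewrite big_nil; under [in leRHS]eq_fun do rewrite big_nil;
    rewrite !distrF_cst.
have ms d0 (S : measurableType d0) (W : I -> S -> R) :
    (forall i, measurable_fun setT (W i)) ->
    measurable_fun setT (fun w => \sum_(i <- r) W i w).
  by move=> mW; apply: measurable_sum.
have := @distrF_add_le _ _ _ _ _ P P' (X i) (fun w => \sum_(i <- r) X i w) (Y i)
  (fun w => \sum_(i <- r) Y i w) (e i) (\sum_(i <- r) e i) (f i) (\sum_(i <- r) f i).
move=> /(_ (mX i) (ms _ _ _ mX) (mY i) (ms _ _ _ mY)).
move=> /(_ (indep_fam_sum mX iX ir) (indep_fam_sum mY iY ir) (f0 i)).
move=> /(_ (sumr_ge0 _ (fun i _ => f0 i)) (hXY i) (IH ur) t).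
have consE S (W : I -> S -> R) : (fun w => \sum_(k <- i :: r) W k w) =
    (fun w => W i w + \sum_(k <- r) W k w) by apply/funext => w; rewrite big_cons.
by rewrite !big_cons !consE.
Qed.

(** * Continuity points, tails, and the one-sided uniform bound from convergence in distribution *)

(** A monotone function has countably many discontinuities, while the interval has positive Lebesgue
    measure. *)
Lemma exists_continuity_point (R : realType) (F : R -> R) (a b : R) :
  {homo F : x y / x <= y} -> right_continuous F -> a < b ->
  exists c, [/\ a < c, c < b & {for c, continuous F}].
Proof.
move=> ndF rcF ab.
have cD : countable [set x | x \in (`]a, b[) /\ discontinuity F x].
  by apply: discontinuity_countable => x y _ _; exact: ndF.
have [c [cab nc]] : exists c, c \in (`]a, b[) /\ ~ discontinuity F c.
  apply: contrapT => /forallNP h.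
  have : (lebesgue_measure (`]a, b[%classic : set R) = 0)%E.
    apply: countable_lebesgue_measure0; apply: sub_countable cD.
    apply: subset_card_le => x /= xab; split => //.
    by apply: contrapT => xn; exact: (h x).
  rewrite lebesgue_measure_itv/= lte_fin ab => /eqP.
  by rewrite -EFinB eqe subr_eq0 gt_eqF.
exists c; move: (cab); rewrite in_itv/= => /andP[ac cb]; split => //.
(* A [discontinuity] has two existing but different one-sided limits. Both exist here by
   monotonicity and right continuity, so they agree, with common value [F c]. *)
apply/left_right_continuousP; split; last exact: rcF.
have lc : cvg (F x @[x --> c^'-]).
  apply: nondecreasing_at_left_is_cvgr.
    by near=> x => y z _ _; exact: ndF.
  near=> x; exists (F c) => _ /= [y + <-]; rewrite in_itv/= => /andP[_ /ltW].
  exact: ndF.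
have rc : cvg (F x @[x --> c^'+]) by apply/cvg_ex; exists (F c); exact: rcF.
suff <- : lim (F x @[x --> c^'-]) = F c by exact: lc.
rewrite -[RHS](cvg_lim _ (rcF c))//; apply/eqP; apply: contrapT => /negP lr.
exact: nc.
Unshelve. all: by end_near. Qed.

Section distribution_function.
Context d (T : measurableType d) (R : realType) (P : probability T R) (Z : T -> R).
Hypothesis mZ : measurable_fun setT Z.
Let z : {mfun T >-> R} := mfun_Sub (mem_set mZ).

Let cdfE : cdf (P := P) z = EFin \o distrF P Z.
Proof.
by apply/funext => t; rewrite /= distrFE.
Qed.

Lemma distrF_nd : {homo distrF P Z : x y / x <= y}.
Proof. by move=> x y xy; apply: le_distrF => // w /le_trans; apply. Qed.

Lemma distrF_right_continuous : right_continuous (distrF P Z).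
Proof.
move=> t; have := @cdf_right_continuous _ _ _ P z t.
by rewrite cdfE => /fine_cvgP[].
Qed.

Lemma distrF_Ny e : 0 < e -> exists a, distrF P Z a <= e.
Proof.
move=> e0; have := @cvg_cdfNy0 _ _ _ P z; rewrite cdfE => /fine_cvgP[_].
move=> /cvgrPdist_le /(_ _ e0) [M [_ h]].
exists (M - 1); have := h (M - 1); rewrite sub0r normrN/= => /(_ _)/ler_normlW; apply.
by rewrite ltrBlDr ltrDl.
Qed.

Lemma distrF_y e : 0 < e -> exists a, 1 - e <= distrF P Z a.
Proof.
move=> e0; have := @cvg_cdfy1 _ _ _ P z; rewrite cdfE => /fine_cvgP[_].
move=> /cvgrPdist_le /(_ _ e0) [M [_ h]].
exists (M + 1); have := h (M + 1); rewrite /= ltrDl ltr01 => /(_ isT)/ler_normlW.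
by rewrite lerBlDl -lerBlDr.
Qed.

End distribution_function.

(** Finitely many continuity points give uniformity in [x]: far left [F x] is at most [f], far right
    [Fn n] is at least [1 - f], and a finite grid of mesh [e / 2] covers the rest. *)
Lemma cvg_in_distr_shift d (T : measurableType d) (R : realType) (P : probability T R)
    (Z : T -> R) (Fn : nat -> R -> R) :
  measurable_fun setT Z -> (forall n, {homo Fn n : x y / x <= y}) ->
  (forall n x, 0 <= Fn n x) -> cvg_in_distr Fn (distrF P Z) ->
  forall e f : R, 0 < e -> 0 < f ->
  \forall n \near \oo, forall x, distrF P Z x <= Fn n (x + e) + f.
Proof.
move=> mZ ndFn Fn0 cv e f e0 f0; set F := distrF P Z.
have f20 : 0 < f / 2 by rewrite divr_gt0.
have cp := exists_continuity_point (distrF_nd P mZ)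
  (distrF_right_continuous (P := P) mZ).
have near_le c g : {for c, continuous F} -> 0 < g -> \forall n \near \oo, F c <= Fn n c + g.
  move=> cc g0; have /cvgrPdist_le/(_ _ g0) := cv c cc.
  by apply: filterS => n /ler_normlW; rewrite lerBlDl.
have [a aF] := distrF_Ny P mZ f0.
(* The bound extends to the right by e / 2 at a time: a continuity point c in
   ]b + e / 2, b + e[ satisfies x <= c <= x + e for all x in ]b, b + e / 2]. *)
have H (k : nat) : \forall n \near \oo, forall x,
    x <= a + k%:R * (e / 2) -> F x <= Fn n (x + e) + f.
  elim: k => [|k IH].
    near=> n => x; rewrite mul0r addr0 => xa.
    apply: (le_trans (distrF_nd P mZ xa)); apply: (le_trans aF).
    by rewrite lerDr.
  set b := a + k%:R * (e / 2) in IH.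
  have [c [bc cb cc]] := cp (b + e / 2) (b + e) ltac:(lra).
  near=> n => x xk.
  have [xb|bx] := leP x b; first by move: xb; move: x {xk}; near: n.
  have xc : x <= c by move: xk; rewrite -natr1 mulrDl mul1r addrA -/b; lra.
  apply: (le_trans (distrF_nd P mZ xc)).
  apply: (@le_trans _ _ (Fn n c + f)); first by near: n; exact: near_le.
  by rewrite lerD2r; apply: ndFn; lra.
(* Right tail: one half of [f] pays for [1 - F c], the other for [F c - Fn n c]. *)
have [c0 c0F] := distrF_y P mZ f20.
have [c [c0c _ cc]] := cp c0 (c0 + 1) ltac:(lra).
(* The number of steps of length [e / 2] that lead from [a] to [c] or beyond. *)
pose k := (Num.truncn ((c - a) / (e / 2))).+1.
have kc : c <= a + k%:R * (e / 2).
  rewrite -lerBlDl -ler_pdivrMr ?divr_gt0//; exact/ltW/truncnS_gt.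
near=> n => x.
have [xc|cx] := leP x c.
  have : x <= a + k%:R * (e / 2) by exact: le_trans kc.
  by move: x {xc}; near: n.
have h : F c <= Fn n c + f / 2 by near: n; exact: near_le.
have h1 : F x <= 1 by exact: distrF_le1.
have h2 : 1 - f / 2 <= F c by apply: (le_trans c0F); apply: distrF_nd => //; exact: ltW.
have h3 : Fn n c <= Fn n (x + e) by apply: ndFn; lra.
lra.
Unshelve. all: by end_near. Qed.

(** * Affine changes of variable, and passage of the [D_minus] inequality to the limit *)

Lemma distrF_affine d (T : measurableType d) (R : realType) (P : probability T R)
    (X : T -> R) (a b t : R) : 0 < a ->
  distrF P (fun w => a * X w - b) t = distrF P X ((t + b) / a).
Proof.
move=> a0; rewrite /distrF; congr (fine (P _)); apply/seteqP; split=> w /=;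
  by rewrite lerBlDr ler_pdivlMr// mulrC.
Qed.

Lemma distrF_scale_le d (T : measurableType d) d' (T' : measurableType d') (R : realType)
    (P : probability T R) (P' : probability T' R) (X : T -> R) (Y : T' -> R) (c e f : R) :
  0 <= c -> 0 <= f -> (forall x, distrF P X x <= distrF P' Y (x + e) + f) ->
  forall x, distrF P (fun w => c * X w) x <= distrF P' (fun w => c * Y w) (x + c * e) + f.
Proof.
move=> c0 f0 h x; have [->|cn0] := eqVneq c 0.
  under eq_fun do rewrite mul0r; under [X in distrF P' X]eq_fun do rewrite mul0r.
  by rewrite !distrF_cst mul0r addr0 lerDl.
have c_gt0 : 0 < c by rewrite lt_neqAle eq_sym cn0.
under eq_fun do rewrite -[c * _]subr0; under [X in distrF P' X]eq_fun do rewrite -[c * _]subr0.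
by rewrite !distrF_affine// !addr0 mulrDl mulrAC divff// mul1r.
Qed.

Lemma indep_fam_comp d (T : measurableType d) (R : realType) (P : probability T R)
    (I : finType) (X : I -> T -> R) (h : I -> R -> R) :
  (forall i, measurable_fun setT (h i)) -> indep_fam P X ->
  indep_fam P (fun i w => h i (X i w)).
Proof.
move=> mh iX B mB; apply: (iX (fun i => h i @^-1` B i)) => i.
by rewrite -[X in measurable X]setTI; exact: mh.
Qed.

(** The [Y i] need only lie below the law [Fn n] in the stochastic order, and their weighted sum
    above it. With F the limit, the chain is: weighted sum of the [X i] at [t], that of the [Y i] at
    [v] plus an error, [Fn n v], F at [v], F at [t], for a continuity point [v] slightly right of
    [t]. *)
Lemma D_minus_limit d (T : measurableType d) (R : realType) (P : probability T R)
    (Z : T -> R) (Fn : nat -> R -> R) :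
  measurable_fun setT Z -> (forall n, {homo Fn n : x y / x <= y}) ->
  (forall n x, 0 <= Fn n x) -> cvg_in_distr Fn (distrF P Z) ->
  (forall n k (c : 'I_k.+1 -> R), (forall i, 0 <= c i) -> \sum_i c i = 1 ->
    exists d' (S : measurableType d') (Q : probability S R) (Y : 'I_k.+1 -> S -> R),
    [/\ forall i, measurable_fun setT (Y i), indep_fam Q Y,
        forall i x, Fn n x <= distrF Q (Y i) x &
        forall x, distrF Q (fun w => \sum_i c i * Y i w) x <= Fn n x]) ->
  D_minus (distrF P Z).
Proof.
move=> mZ ndFn Fn0 cv H d' T' P' k c X c0 c1 mX /indep_finE iX lX t.
rewrite lX; apply/ler_addgt0Pr => f f0.
have f20 : 0 < f / 2 by rewrite divr_gt0.
have /cvgrPdist_le/(_ _ f20) rc : distrF P Z x @[x --> t^'+] --> distrF P Z t.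
  exact: distrF_right_continuous.
have [u [tu rcu]] : exists u, t < u /\
    forall v, t < v -> v < u -> distrF P Z v <= distrF P Z t + f / 2.
  move: rc; rewrite near_withinE => -[e /= e0 he]; exists (t + e).
  split; first by rewrite ltrDl.
  move=> v tv vu; rewrite -lerBlDl; apply: ler_normlW; rewrite distrC; apply: he => //=.
  by rewrite ltr_norml; lra.
have [v [tv vu cZv]] := exists_continuity_point (distrF_nd P mZ)
  (distrF_right_continuous (P := P) mZ) tu.
(* Each of the [k.+1] summands costs [g], and comparing [Fn n v] with the limit costs one more, in
   all [f / 2]; the step from [v] back to [t] takes the other half. *)
pose g := f / 2 / k.+2%:R.
have g0 : 0 < g by rewrite divr_gt0.
have vt0 : 0 < v - t by rewrite subr_gt0.
have N1 := cvg_in_distr_shift mZ ndFn Fn0 cv vt0 g0.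
have N2 : \forall n \near \oo, Fn n v <= distrF P Z v + g.
  have /cvgrPdist_le/(_ _ g0) := cv v cZv.
  by apply: filterS => n; rewrite distrC => /ler_normlW; rewrite lerBlDl.
near \oo => n.
have n1 : forall x, distrF P Z x <= Fn n (x + (v - t)) + g by near: n.
have n2 : Fn n v <= distrF P Z v + g by near: n.
have [d2 [S [Q [Y [mY iY lY sY]]]]] := H n k c c0 c1.
have mscale i : measurable_fun setT (fun x : R => c i * x).
  by apply: measurable_funM => //; exact: measurable_cst.
(* The shifts [c i * (v - t)] add up to [v - t] because the weights sum to 1. *)
have := @distrF_sum_le _ _ _ _ _ P' Q _ (fun i w => c i * X i w) (fun i w => c i * Y i w)
  (fun i => c i * (v - t)) (fun=> g).
move=> /(_ (fun i => measurable_funM (measurable_cst _) (mX i))).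
move=> /(_ (fun i => measurable_funM (measurable_cst _) (mY i))).
move=> /(_ (indep_fam_comp mscale iX) (indep_fam_comp mscale iY) (fun=> ltW g0)).
have hXY i x : distrF P' (fun w => c i * X i w) x <=
    distrF Q (fun w => c i * Y i w) (x + c i * (v - t)) + g.
  apply: distrF_scale_le => [//||{}x]; first exact: ltW.
  by rewrite lX; apply: (le_trans (n1 x)); rewrite lerD2r lY.
move=> /(_ hXY t); rewrite -mulr_suml c1 mul1r sumr_const card_ord [t + _]addrC subrK.
move=> h1; have h2 := sY v; have h3 := rcu v tv vu.
have h4 : g *+ k.+1 + g = f / 2 by rewrite -mulrSr /g -[LHS]mulr_natr divfK.
lra.
Unshelve. all: by end_near. Qed.

(** * Measurable, stochastically monotone and sublinear aggregates *)

Section aggregation.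
Context (R : realType) (agg : forall n, ('I_n.+1 -> R) -> R).

Hypothesis agg_measurable : forall n d (T : measurableType d) (X : 'I_n.+1 -> T -> R),
  (forall j, measurable_fun setT (X j)) ->
  measurable_fun setT (fun w => agg (fun j => X j w)).

Hypothesis agg_st_le : forall n d (T : measurableType d) (P : probability T R)
    (X Y : 'I_n.+1 -> T -> R),
  (forall j, measurable_fun setT (X j)) -> (forall j, measurable_fun setT (Y j)) ->
  indep_fam P X -> indep_fam P Y ->
  (forall j t, distrF P (X j) t <= distrF P (Y j) t) ->
  forall t, distrF P (fun w => agg (fun j => X j w)) t <=
            distrF P (fun w => agg (fun j => Y j w)) t.

Hypothesis agg_sublinear : forall n k (c : 'I_k.+1 -> R) (x : 'I_k.+1 -> 'I_n.+1 -> R),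
  (forall i, 0 <= c i) ->
  agg (fun j => \sum_i c i * x i j) <= \sum_i c i * agg (x i).

Lemma agg_domain_D_minus d (T : measurableType d) (P : probability T R)
    d1 (T1 : measurableType d1) (P1 : probability T1 R)
    (FX : R -> R) (Xs : nat -> T -> R) (Z : T1 -> R) (a b : nat -> R) :
  D_minus FX -> measurable_fun setT Z ->
  (forall i, measurable_fun setT (Xs i)) -> indep_seq P Xs ->
  (forall i t, distrF P (Xs i) t = FX t) -> (forall n, 0 < a n) ->
  cvg_in_distr (fun n => distrF P (fun w => a n * agg (fun j : 'I_n.+1 => Xs j w) - b n))
    (distrF P1 Z) ->
  D_minus (distrF P1 Z).
Proof.
move=> DX mZ mXs iXs lXs a0 cv.
have maff n d' (S : measurableType d') (X : 'I_n.+1 -> S -> R) :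
    (forall j, measurable_fun setT (X j)) ->
    measurable_fun setT (fun w => a n * agg (fun j => X j w) - b n).
  move=> mX; apply: measurable_funB; last exact: measurable_cst.
  by apply: measurable_funM; [exact: measurable_cst|exact: agg_measurable].
apply: (D_minus_limit mZ _ _ cv) => [n|n x|n k c c0 c1].
- by apply: distrF_nd; exact: maff.
- exact: distrF_ge0.
(* An initial segment of the sequence, reindexed by pairs: [i] is the row, [j] the column. *)
pose X (p : 'I_k.+1 * 'I_n.+1) := Xs (enum_rank p).
have iX : indep_fam P X.
  apply: (@indep_fam_inj _ _ _ P 'I_#|{: 'I_k.+1 * 'I_n.+1}| _ enum_rank (fun i => Xs i)).
    exact: enum_rank_inj.
  exact/indep_finE/iXs.
have mX p : measurable_fun setT (X p) by exact: mXs.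
pose Tc j w := \sum_i c i * X (i, j) w.
have mTc j : measurable_fun setT (Tc j).
  by apply: measurable_sum => i; apply: measurable_funM => //; exact: measurable_cst.
(* The witnesses are the normalised aggregates of the rows, independent because the rows are
   disjoint blocks. *)
exists _, T, P, (fun i w => a n * agg (fun j => X (i, j) w) - b n); split.
- by move=> i; exact: maff.
- apply: (indep_fam_group (g := fst) mX iX) => i; apply: maff => j.
  by apply: measurable_block; rewrite /= eqxx.
- move=> i x; rewrite !distrF_affine//; apply: agg_st_le => //.
  + exact/indep_finE/iXs.
  + by apply: (indep_fam_inj (h := fun j => (i, j)) _ iX) => j1 j2 [].
  + by move=> j t; rewrite !lXs.
- move=> x; apply: (@le_trans _ _
    (distrF P (fun w => a n * agg (fun j => Tc j w) - b n) x)).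
    apply: le_distrF => [||w].
    + apply: measurable_sum => i; apply: measurable_funM; first exact: measurable_cst.
      exact: maff.
    + exact: maff.
    (* Since the weights sum to 1, the centering [b n] is common to both sides and cancels, leaving
       sublinearity. *)
    + apply: le_trans; under eq_bigr do rewrite mulrBr mulrCA.
      rewrite sumrB -mulr_sumr -mulr_suml c1 mul1r lerD2r ler_pM2l//.
      exact: agg_sublinear.
  rewrite !distrF_affine//; apply: agg_st_le => //.
  + apply: (indep_fam_group (g := snd) mX iX) => j; apply: measurable_sum => i.
    apply: measurable_funM; first exact: measurable_cst.
    by apply: measurable_block; rewrite /= eqxx.
  + exact/indep_finE/iXs.
  (* Within column [j], the variable that [D_minus] compares with the weighted sum is the one in row
     [ord0], which has the law of [Xs j]. *)
  + move=> j t; rewrite lXs -(lXs (enum_rank (ord0 : 'I_k.+1, j))).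
    apply: (DX _ T P k c (fun i => X (i, j))) => //.
    * by move=> i; exact: mX.
    * by apply/indep_finE/(indep_fam_inj (h := fun i => (i, j)) _ iX) => i1 i2 [].
    * by move=> i s; exact: lXs.
Qed.

End aggregation.

(** * Maxima, and the two domains of attraction *)

Lemma measurable_bigmax d (T : measurableType d) (R : realType) (I : Type) (r : seq I)
    (X : I -> T -> R) (X0 : T -> R) :
  measurable_fun setT X0 -> (forall j, measurable_fun setT (X j)) ->
  measurable_fun setT (fun w => \big[Num.max/X0 w]_(j <- r) X j w).
Proof.
move=> mX0 mX; elim: r => [|j r IH]; first by under eq_fun do rewrite big_nil.
by under eq_fun do rewrite big_cons; exact: measurable_maxr.
Qed.

(** A maximum is at most [t] exactly when every term is. The default value [X ord0] is itself one of
    the terms, so it adds no condition. *)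
Lemma distrF_bigmax d (T : measurableType d) (R : realType) (P : probability T R)
    n (X : 'I_n.+1 -> T -> R) t : (forall j, measurable_fun setT (X j)) -> indep_fam P X ->
  distrF P (fun w => \big[Num.max/X ord0 w]_j X j w) t = \prod_j distrF P (X j) t.
Proof.
move=> mX iX; apply: EFin_inj; rewrite -prodEFin.
rewrite (eq_bigr (fun j => P (X j @^-1` [set y | y <= t]))); last first.
  by move=> j _; exact: distrFE.
rewrite -iX; last by move=> _; exact: (measurable_le_cst (@measurable_id _ R setT)).
rewrite distrFE; last exact: measurable_bigmax.
congr (P _); apply/seteqP; split=> w /=.
  rewrite -bigcap_seq => h j _ /=; apply: le_trans h; exact: le_bigmax.
rewrite -bigcap_seq => h; apply: bigmax_le => [|j _]; by apply: h; rewrite /= mem_index_enum.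
Qed.

Theorem theorem3 (R : realType)
  (d0 : measure_display) (T0 : measurableType d0) (P0 : probability T0 R) (X : T0 -> R)
  (d1 : measure_display) (T1 : measurableType d1) (P1 : probability T1 R) (Z : T1 -> R) :
  realRV X -> realRV Z -> D_minus (distrF P0 X) ->
  (sum_domain_attr (distrF P0 X) (distrF P1 Z) -> D_minus (distrF P1 Z)) /\
  (max_domain_attr (distrF P0 X) (distrF P1 Z) -> D_minus (distrF P1 Z)).
Proof.
move=> _ mZ DX; split=> -[d [T [P [Xs [a [b [mXs [iXs [lXs [a0 cv]]]]]]]]]].
(* For sums, monotonicity is [distrF_sum_le] with zero errors, and sublinearity is an equality. *)
- apply: (agg_domain_D_minus (agg := fun n x => \sum_(j < n.+1) x j)
    _ _ _ DX mZ mXs iXs lXs a0 cv).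
  + by move=> n d' S Y mY; exact: measurable_sum.
  + move=> n d' S Q Y W mY mW iY iW lYW t.
    have := @distrF_sum_le _ S _ S R Q Q _ Y W (fun=> 0) (fun=> 0) mY mW iY iW (fun=> lexx _).
    by rewrite !big1// => /(_ _ t); rewrite !addr0; apply => j x; rewrite !addr0.
  + move=> n k c x c0; rewrite exchange_big/=.
    by under eq_bigr do rewrite -mulr_sumr.
(* For maxima, monotonicity follows from the product formula for distribution functions, whose
   factors are nonnegative; sublinearity holds because each entry is at most the maximum of its
   row. *)
- apply: (agg_domain_D_minus (agg := fun n x => \big[Num.max/x ord0]_(j < n.+1) x j)
    _ _ _ DX mZ mXs iXs lXs a0 cv).
  + by move=> n d' S Y mY; exact: measurable_bigmax.
  + move=> n d' S Q Y W mY mW iY iW lYW t.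
    rewrite !distrF_bigmax//; apply: ler_prod => j _.
    by rewrite lYW distrF_ge0.
  + move=> n k c x c0.
    have h j : \sum_i c i * x i j <= \sum_i c i * \big[Num.max/x i ord0]_j x i j.
      by apply: ler_sum => i _; rewrite ler_wpM2l//; exact: le_bigmax.
    exact: bigmax_le.
Qed.
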